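(* Let $\mathcal{X}$ be a finite-dimensional Euclidean space, let $\mathcal{H}\subset\mathbb{S}$ be a linear subspace of self-adjoint operators on $\mathcal{X}$ satisfying properties (i)–(iii) of the context, let $\eta>0$, and let $\mathbf{S}_k,\mathbf{S}_{k+1}\in\mathcal{H}\cap\mathbb{S}_{++}$ with $\mathbf{S}_{k+1}\succeq\mathbf{S}_k$. For $j\in\{k,k+1\}$ let $\Psi_j^*(m)=\eta\,\big\|\sqrt{\mathrm{proj}_{\mathcal{H}}(\mathbf{out}(m))+\mathbf{S}_j}\big\|_{\mathrm{tr}}$ for $m\in\mathcal{X}$. Then, for all $m\in\mathcal{X}$, $$\big\|\nabla\Psi_{k+1}^*(m)-\nabla\Psi_k^*(m)\big\|^2_{\mathbf{S}_{k+1}^{1/2}}\le \eta^2\Big(\big\|\sqrt{\mathbf{S}_{k+1}}\big\|_{\mathrm{tr}}-\big\|\sqrt{\mathbf{S}_k}\big\|_{\mathrm{tr}}\Big).$$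
   Context: $\mathcal{X}$ is a finite-dimensional real Euclidean space with inner product $\langle\cdot,\cdot\rangle$ and norm $\|\cdot\|$. $\mathbb{S}$ is the space of self-adjoint linear operators $\mathcal{X}\to\mathcal{X}$ with inner product $\langle\mathbf{A},\mathbf{B}\rangle=\mathrm{tr}(\mathbf{A}\mathbf{B}^* )$; $\mathbb{S}_{++}\subset\mathbb{S}$ is the set of positive definite operators; $\succeq$ is the Löwner order; $\mathbf{I}$ is the identity operator. $\|\mathbf{A}\|_{\mathrm{tr}}=\mathrm{tr}\sqrt{\mathbf{A}\mathbf{A}^*}$ is the trace norm. For $\mathbf{H}\in\mathbb{S}_{++}$, $\|x\|_{\mathbf{H}}^2=\langle x,\mathbf{H}x\rangle$. For $z\in\mathcal{X}$, $\mathbf{out}(z)\in\mathbb{S}$ is the rank-one operator $x\mapsto z\langle z,x\rangle$. $\mathrm{proj}_{\mathcal{H}}$ is the orthogonal projection of $\mathbb{S}$ onto $\mathcal{H}$. The linear subspace $\mathcal{H}\subset\mathbb{S}$ satisfies: (i) $\mathbf{I}\in\mathcal{H}$; (ii) $\mathbf{H}\mathbf{F}\mathbf{H}\in\mathcal{H}$ for all $\mathbf{H},\mathbf{F}\in\mathcal{H}$; (iii) $\mathrm{proj}_{\mathcal{H}}(\mathbf{H})\in\mathbb{S}_{++}$ for all $\mathbf{H}\in\mathbb{S}_{++}$. The functions $\Psi_j^*$ are differentiable on $\mathcal{X}$, with $\nabla\Psi_j^*(m)=\eta\,[\mathrm{proj}_{\mathcal{H}}(\mathbf{out}(m))+\mathbf{S}_j]^{-1/2}m$.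 *)

(* Defs.v *)
From mathcomp Require Import all_boot all_order all_algebra.
From mathcomp Require Import all_classical all_reals.

Set Implicit Arguments.
Unset Strict Implicit.
Unset Printing Implicit Defensive.

Import Order.TTheory GRing.Theory Num.Theory.
Local Open Scope classical_set_scope.
Local Open Scope ring_scope.

(* The Euclidean space is a finite-dimensional real vector space X together
   with an inner product ip, a positive definite symmetric bilinear form.
   Linear operators are elements of 'End(X), composed by \o in lfun_scope.
   Objects characterized by a property (adjoint, square root, projection,
   gradient) are selected by xget, which returns 0 if no object has it. *)

Section Euclidean.
Variables (R : realType) (X : vectType R) (ip : {dot X for (@idfun R)}).
Implicit Types (A B C : 'End(X)) (x y z g h : X) (H : {vspace 'End(X)}).

Definition enorm x : R := Num.sqrt (ip x x).

Definition adjoint A : 'End(X) :=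
  xget 0 [set B : 'End(X) | forall x y, ip (A x) y = ip x (B y)].

Definition selfadjoint A : Prop := forall x y, ip (A x) y = ip x (A y).

Definition psd A : Prop := selfadjoint A /\ forall x, 0 <= ip x (A x).

Definition posdef A : Prop :=
  selfadjoint A /\ forall x, x != 0 -> 0 < ip x (A x).

Definition loewner_le A B : Prop := psd (B - A).

(* The basis chosen to write the matrix is immaterial. *)
Definition optrace A : R :=
  \tr (passmx.mxof (vbasis {:X}) (vbasis {:X}) A).

Definition opip A B : R := optrace (A \o adjoint B)%VF.

Definition opsqrt A : 'End(X) :=
  xget 0 [set B : 'End(X) | psd B /\ (B \o B)%VF = A].

Definition trnorm A : R := optrace (opsqrt (A \o adjoint A)%VF).

Definition opnormsq A x : R := ip x (A x).

Definition out z : 'End(X) := linfun (fun x => ip z x *: z).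

Definition orthproj H A : 'End(X) :=
  xget 0 [set B : 'End(X) | B \in H /\ forall C, C \in H -> opip (A - B) C = 0].

Definition Psi_star H (eta : R) (S : 'End(X)) (m : X) : R :=
  eta * trnorm (opsqrt (orthproj H (out m) + S)).

(* f is Frechet differentiable at x, with derivative h |-> ip g h. *)
Definition is_gradient (f : X -> R) x g : Prop :=
  forall eps : R, 0 < eps -> exists2 delta : R, 0 < delta &
    forall h, enorm h < delta ->
      `|f (x + h) - f x - ip g h| <= eps * enorm h.

Definition gradient (f : X -> R) x : X := xget 0 [set g : X | is_gradient f x g].

End Euclidean.

(* Main.v *)
From HB Require Import structures.
Require Import Defs.
From mathcomp Require Import all_boot all_order all_algebra.
From mathcomp Require Import all_classical all_reals.
From mathcomp Require Import complex ring lra.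

(* Write M = proj_H (out m), A_j = M + S_j, B_j = A_j^(1/2), and let k, k+1 be
   0, 1.  H contains all polynomials in its elements, hence B_j, B_j^-1 and,
   for D = B_1^-1 - B_0^-1, the operator D B_1 D; testing it against out m is
   thus the same as testing it against M.  The gradients are eta B_j^-1 m, so
   monotonicity of the square root and M <= A_0 give
     |D m|^2_(S_1^(1/2)) <= <D m, B_1 D m> = tr (M D B_1 D) <= tr (A_0 D B_1 D)
       = tr (B_0 B_1^-1 B_0) - 2 tr B_0 + tr B_1 <= tr B_1 - tr B_0,
   the last step because B_1^-1 <= B_0^-1.  Finally
   t |-> tr sqrt (t M + S_1) - tr sqrt (t M + S_0) is nonincreasing, its
   derivative being half of tr (M (sqrt (t M + S_1)^-1 - sqrt (t M + S_0)^-1)),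
   so tr B_1 - tr B_0 <= tr sqrt S_1 - tr sqrt S_0. *)

Set Implicit Arguments.
Unset Strict Implicit.
Unset Printing Implicit Defensive.

Import Order.TTheory GRing.Theory Num.Theory passmx.
Local Open Scope ring_scope.

(** * Polynomials in an operator *)

Section OperatorPolynomials.
Variables (R : fieldType) (X : vectType R).
Implicit Types (A : 'End(X)) (p q : {poly R}) (x : X).

Fixpoint oppow A n : 'End(X) :=
  if n is n'.+1 then (A \o oppow A n')%VF else \1%VF.

Lemma oppowSr A n : oppow A n.+1 = (oppow A n \o A)%VF.
Proof.
elim: n => [|n IHn]; first by rewrite /= comp_lfun1l comp_lfun1r.
by rewrite -[LHS]/(A \o oppow A n.+1)%VF {1}IHn comp_lfunA.
Qed.

(* horner_alg does not apply: 'End(X) is not an nzRingType, as X may be 0. *)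
Definition opoly A p : 'End(X) := \sum_(i < size p) p`_i *: oppow A i.

Lemma opoly_widen n A p : (size p <= n)%N ->
  opoly A p = \sum_(i < n) p`_i *: oppow A i.
Proof.
move=> le_pn; rewrite /opoly (big_ord_widen n (fun i => p`_i *: oppow A i)) //.
rewrite big_mkcond; apply: eq_bigr => i _.
by case: ltnP => // le_pi; rewrite nth_default ?scale0r.
Qed.

Lemma opolyD A p q : opoly A (p + q) = opoly A p + opoly A q.
Proof.
set n := maxn (size p) (size q).
rewrite !(@opoly_widen n) ?leq_maxl ?leq_maxr ?size_polyD //.
by rewrite -big_split; apply: eq_bigr => i _; rewrite coefD scalerDl.
Qed.

Lemma opolyZ A a p : opoly A (a *: p) = a *: opoly A p.
Proof.
rewrite !(@opoly_widen (size p)) ?size_scale_leq // scaler_sumr.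
by apply: eq_bigr => i _; rewrite coefZ scalerA.
Qed.

Lemma opoly0 A : opoly A 0 = 0.
Proof. by rewrite /opoly size_poly0 big_ord0. Qed.

Lemma opolyC A a : opoly A a%:P = a *: \1%VF.
Proof. by rewrite (@opoly_widen 1) ?size_polyC_leq1 // big_ord1 coefC. Qed.

Lemma opolyMX A p : opoly A (p * 'X) = (A \o opoly A p)%VF.
Proof.
rewrite (@opoly_widen (size p).+1); last first.
  by rewrite (leq_trans (size_polyMleq _ _)) // size_polyX addn2.
rewrite big_ord_recl coefMX scale0r add0r /opoly.
apply/lfunP => x; rewrite comp_lfunE !sum_lfunE linear_sum.
by apply: eq_bigr => i _; rewrite coefMX !lfunE /= lfunE linearZ.
Qed.

Lemma opolyX A : opoly A 'X = A.
Proof. by rewrite -['X]mul1r opolyMX opolyC scale1r comp_lfun1r. Qed.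

Lemma opolyM A p q : opoly A (p * q) = (opoly A p \o opoly A q)%VF.
Proof.
elim/poly_ind: p => [|p a IHp]; first by rewrite mul0r opoly0 comp_lfun0l.
rewrite mulrDl mulrAC !opolyD !opolyMX IHp mul_polyC opolyZ opolyC.
by rewrite comp_lfunDl comp_lfunA -comp_lfunZl comp_lfun1l.
Qed.

Lemma opoly_XsubC A a x : opoly A ('X - a%:P) x = A x - a *: x.
Proof.
by rewrite -polyCN opolyD opolyX opolyC add_lfunE scale_lfunE id_lfunE scaleNr.
Qed.

(** The powers of [A] from 0 to dim End(X) are one too many to be linearly independent; a vanishing
    combination supplies the coefficients. *)
Lemma exists_annihilating_poly A : exists2 p, p != 0 & opoly A p = 0.
Proof.
set n := (\dim {: 'End(X)}).+1.
pose t := [tuple oppow A i | i < n].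
have t_dep : ~~ free t.
  apply/negP => /eqP dim_t; have := dimvS (subvf <<t>>%VS).
  by rewrite dim_t size_tuple ltnn.
have /existsNP [k] : ~ (forall k : 'I_n -> R, \sum_(i < n) k i *: t`_i = 0 ->
    forall i, k i = 0) by move=> t0; case/negP: t_dep; apply/freeP.
move=> /not_implyP [k0 /existsNP [i /eqP ki0]].
exists (\poly_(j < n) k (inord j)).
  apply: contraNneq ki0 => /(congr1 (fun p : {poly R} => p`_i)).
  by rewrite /= coef_poly coef0 ltn_ord inord_val => ->.
rewrite (opoly_widen _ (size_poly _ _)) -[RHS]k0; apply: eq_bigr => j _.
by rewrite coef_poly ltn_ord inord_val -tnth_nth tnth_mktuple.
Qed.

Lemma interpolation (s : seq R) (f : R -> R) : uniq s ->
  exists p, forall a, a \in s -> p.[a] = f a.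
Proof.
elim: s => [|b s IHs] /=; first by exists 0.
case/andP => b_s /IHs [p p_f].
pose w := \prod_(z <- s) ('X - z%:P).
have wb0 : w.[b] != 0 by rewrite -rootE root_prod_XsubC.
(* Newton step: [w] vanishes on [s] but not at [b], so a multiple of it corrects the value at [b]
   alone. *)
exists (p + ((f b - p.[b]) / w.[b]) *: w) => a; rewrite in_cons !hornerE.
case/predU1P => [->|a_s]; first by rewrite divfK // addrC subrK.
by have /rootP -> : root w a; rewrite ?root_prod_XsubC // mulr0 addr0 p_f.
Qed.

(** Since the roots in [s] are distinct, their product divides [p - q], and it annihilates [A]. Thus
    identities between polynomials in [A] can be checked pointwise on [s]. *)
Lemma eq_opoly A (s : seq R) p q : uniq s ->
    opoly A (\prod_(a <- s) ('X - a%:P)) = 0 ->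
  (forall a, a \in s -> p.[a] = q.[a]) -> opoly A p = opoly A q.
Proof.
move=> uniq_s As0 eq_pq; apply/eqP; rewrite -subr_eq0.
have -> : opoly A p - opoly A q = opoly A (p - q).
  by rewrite opolyD -scaleN1r -opolyZ scaleN1r.
have /dvdpP [r ->] : \prod_(a <- s) ('X - a%:P) %| p - q.
  apply: uniq_roots_dvdp; last by rewrite uniq_rootsE.
  by apply/allP => a /eq_pq eq_a; rewrite rootE !hornerE eq_a subrr.
by rewrite opolyM As0 comp_lfun0r.
Qed.

End OperatorPolynomials.

(** * Linearity and cyclicity of the trace *)

Section Trace.
Variables (R : realType) (X : vectType R).
Implicit Types (A B C : 'End(X)).

Lemma optraceD A B : optrace (A + B) = optrace A + optrace B.
Proof. by rewrite /optrace !linearD. Qed.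

Lemma optraceN A : optrace (- A) = - optrace A.
Proof. by rewrite /optrace !linearN. Qed.

Lemma optraceZ a A : optrace (a *: A) = a * optrace A.
Proof. by rewrite /optrace !linearZ. Qed.

Lemma optrace0 : optrace (0 : 'End(X)) = 0.
Proof. by rewrite -[0](scale0r (0 : 'End(X))) optraceZ mul0r. Qed.

Lemma optraceC A B : optrace (A \o B)%VF = optrace (B \o A)%VF.
Proof. by rewrite /optrace !(mxof_comp _ _ (vbasisP _)) mxtrace_mulC. Qed.

Lemma optrace_compDl A B C :
  optrace ((A + B) \o C)%VF = optrace (A \o C)%VF + optrace (B \o C)%VF.
Proof. by rewrite comp_lfunDl optraceD. Qed.
Lemma optrace_compDr A B C :
  optrace (A \o (B + C))%VF = optrace (A \o B)%VF + optrace (A \o C)%VF.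
Proof. by rewrite comp_lfunDr optraceD. Qed.
Lemma optrace_compNl A B : optrace (- A \o B)%VF = - optrace (A \o B)%VF.
Proof. by rewrite comp_lfunNl optraceN. Qed.
Lemma optrace_compNr A B : optrace (A \o - B)%VF = - optrace (A \o B)%VF.
Proof. by rewrite comp_lfunNr optraceN. Qed.
Lemma optrace_compZl a A B : optrace (a *: A \o B)%VF = a * optrace (A \o B)%VF.
Proof. by rewrite -comp_lfunZl optraceZ. Qed.
Lemma optrace_compZr a A B : optrace (A \o a *: B)%VF = a * optrace (A \o B)%VF.
Proof. by rewrite -comp_lfunZr optraceZ. Qed.
Definition optrace_bilin := (optrace_compDl, optrace_compDr, optrace_compNl,
  optrace_compNr, optrace_compZl, optrace_compZr).

End Trace.

(** * Inner product and orthonormal expansions *)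

Section Euclidean.
Variables (R : realType) (X : vectType R) (ip : {dot X for (@idfun R)}).
Implicit Types (A B C T : 'End(X)) (x y z : X) (a : R).

Lemma ipC x y : ip x y = ip y x.
Proof. by rewrite hermC expr0 mul1r. Qed.
Lemma ipDl x y z : ip (x + y) z = ip x z + ip y z.
Proof. exact: linearDl. Qed.
Lemma ipDr x y z : ip x (y + z) = ip x y + ip x z.
Proof. exact: linearDr. Qed.
Lemma ipNl x y : ip (- x) y = - ip x y.
Proof. exact: linearNl. Qed.
Lemma ipNr x y : ip x (- y) = - ip x y.
Proof. exact: linearNr. Qed.
Lemma ipZl a x y : ip (a *: x) y = a * ip x y.
Proof. exact: linearZl_LR. Qed.
Lemma ipZr a x y : ip x (a *: y) = a * ip x y.
Proof. exact: linearZr_LR. Qed.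
Lemma ip0l x : ip 0 x = 0. Proof. exact: linear0l. Qed.
Lemma ip0r x : ip x 0 = 0. Proof. exact: linear0r. Qed.
Lemma ip_sumr x (I : finType) (F : I -> X) :
  ip x (\sum_i F i) = \sum_i ip x (F i).
Proof. exact: linear_sumr. Qed.
Definition ipE := (ipDl, ipDr, ipNl, ipNr, ipZl, ipZr).

Lemma ip_gt0 x : x != 0 -> 0 < ip x x. Proof. exact: neq0_dnorm_gt0. Qed.

Lemma ip_ge0 x : 0 <= ip x x.
Proof. by have [->|/ip_gt0/ltW //] := eqVneq x 0; rewrite ip0l. Qed.

Lemma ip_eq0 x : ip x x = 0 -> x = 0.
Proof. by move/eqP; apply: contraTeq => /ip_gt0; rewrite lt0r => /andP []. Qed.

(** Gram-Schmidt along a list, applied to a basis of [X] and extended by linearity. Orthonormality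
    drives the induction; the expansion identity is what trace computations use. *)
Lemma frame_exists : exists n (e : 'I_n -> X),
  forall x, x = \sum_i ip (e i) x *: e i.
Proof.
pose onb n (e : 'I_n -> X) := forall i j, ip (e i) (e j) = (i == j)%:R.
suff frame_span (s : seq X) : exists n (e : 'I_n -> X),
    onb n e /\ forall x, x \in s -> x = \sum_i ip (e i) x *: e i.
  have [n [e [_ e_frame]]] := frame_span (vbasis {:X}); exists n, e => x.
  rewrite [LHS](coord_vbasis (memvf x)) [in RHS](coord_vbasis (memvf x)).
  under [RHS]eq_bigr do rewrite ip_sumr scaler_suml.
  rewrite exchange_big; apply: eq_bigr => j _.
  rewrite [in LHS](e_frame (vbasis {:X})`_j) ?mem_nth ?size_tuple //.
  by rewrite scaler_sumr; apply: eq_bigr => i _; rewrite /= ipZr scalerA.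
elim: s => [|y s [n [e [e_on e_s]]]]; first by exists 0%N, (fun=> 0); split=> [[]|].
pose r := y - \sum_i ip (e i) y *: e i.
have er0 i : ip (e i) r = 0.
  rewrite ipDr ipNr ip_sumr (bigD1 i) //= big1 => [|j /negPf ji].
    by rewrite ipZr e_on eqxx mulr1 addr0 subrr.
  by rewrite ipZr e_on eq_sym ji mulr0.
(* If the residual [r] is 0, [y] is already expanded by the family; otherwise the normalized [r]
   joins it at index 0. *)
have [r0|r_neq0] := eqVneq r 0.
  exists n, e; split=> // x; rewrite in_cons => /predU1P [->|/e_s //].
  by apply/eqP; rewrite -subr_eq0 -/r r0.
pose c := Num.sqrt (ip r r).
have c2 : c * c = ip r r by rewrite -expr2 sqr_sqrtr ?ip_ge0.
have c_neq0 : c != 0 by rewrite sqrtr_eq0 -ltNge ip_gt0.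
exists n.+1, (fun i => if unlift ord0 i is Some j then e j else c^-1 *: r).
split=> [i j|x].
  case: (unliftP ord0 i) => [i' ->|->]; case: (unliftP ord0 j) => [j' ->|->].
  - by rewrite e_on (inj_eq lift_inj).
  - by rewrite ipZr er0 mulr0.
  - by rewrite ipZl ipC er0 mulr0.
  - by rewrite ipZl ipZr -c2 eqxx mulKf // mulVf.
rewrite big_ord_recl unlift_none; under eq_bigr do rewrite liftK.
rewrite ipZl scalerA in_cons => /predU1P [->|/e_s x_e].
  suff -> : ip r y = c * c.
    by rewrite mulKf // mulfV // scale1r subrK.
  rewrite c2 {3}/r ipDr ipNr ip_sumr big1 ?subr0 // => i _.
  by rewrite ipZr (ipC r) er0 mulr0.
suff -> : ip r x = 0 by rewrite mulr0 mul0r scale0r add0r.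
by rewrite x_e ip_sumr big1 // => i _; rewrite ipZr (ipC r) er0 mulr0.
Qed.

(** Expanding [z] in the basis b turns <y, z> into the sum of the diagonal entries, the i-th being
    <y, b_i> times the i-th coordinate of [z]. *)
Lemma optrace_rank1 A y z : (forall x, A x = ip y x *: z) -> optrace A = ip y z.
Proof.
move=> defA; rewrite /optrace /mxtrace.
rewrite [in RHS](coord_vbasis (memvf z)) ip_sumr; apply: eq_bigr => i _.
by rewrite !mxE /= vecof_delta defA linearZ ipZr mulrC.
Qed.

End Euclidean.

(** * Spectral calculus of self-adjoint operators *)

(** Take a complex root a + ib. If b is nonzero, the remainder modulo (X - a)^2 + b^2 is a real
    polynomial of degree at most 1 vanishing at a + ib: the imaginary part kills its slope, then the
    real part its constant term. *)
Lemma real_quadratic_factor (R : rcfType) (p : {poly R}) : size p != 1%N ->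
  exists a b q, p = q * ('X - a%:P) \/
    b != 0 /\ p = (('X - a%:P) ^+ 2 + (b ^+ 2)%:P) * q.
Proof.
move=> szp.
have /closed_rootP [z] : size (map_poly (real_complex R) p) != 1%N.
  by rewrite size_map_poly.
case: z => a b root_z; exists a, b.
have [b0|b_neq0] := eqVneq b 0.
  move: root_z; rewrite b0 fmorph_root => /factor_theorem [q p_q].
  by exists q; left.
set d := _ + _%:P; exists (p %/ d); right; split=> //.
have szd : size d = 3%N.
  rewrite size_polyDl; last first.
    by rewrite size_exp_XsubC (leq_ltn_trans (size_polyC_leq1 _)).
  by rewrite size_exp_XsubC.
have d_neq0 : d != 0 by rewrite -size_poly_eq0 szd.
set r := p %% d.
have r_lin : r = r`_1 *: 'X + (r`_0)%:P.
  have sz_r : (size r <= 2)%N by have := ltn_modp p d; rewrite d_neq0 szd.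
  apply/polyP => -[|[|i]]; rewrite !coefE /= ?mulr1 ?mulr0 ?addr0 ?add0r //.
  by rewrite nth_default // (leq_trans sz_r).
have r_z : root (map_poly (real_complex R) r) (a +i* b)%C.
  move: root_z; rewrite {1}(divp_eq p d) /root rmorphD rmorphM /= hornerD hornerM.
  suff -> : (map_poly (real_complex R) d).[(a +i* b)%C] = 0 by rewrite mulr0 add0r.
  rewrite rmorphD rmorphXn rmorphB /= map_polyX !map_polyC !hornerE /=.
  by apply/eqP; rewrite eq_complex /=; apply/andP; split; apply/eqP; ring.
suff r0 : r = 0 by rewrite {1}(divp_eq p d) -/r r0 addr0 mulrC.
move: r_z; rewrite r_lin /root rmorphD /= linearZ /= map_polyX map_polyC !hornerE.
rewrite eq_complex /= => /andP [re_r im_r].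
have r1 : r`_1 = 0.
  move: im_r; rewrite !(mul0r, addr0) mulf_eq0 (negPf b_neq0) orbF.
  by move/eqP.
move: re_r; rewrite r1 !(mul0r, oppr0, add0r) => /eqP ->.
by rewrite scale0r add0r.
Qed.

Section SelfAdjoint.
Variables (R : realType) (X : vectType R) (ip : {dot X for (@idfun R)}).
Implicit Types (A B C T : 'End(X)) (x y z : X) (a : R) (p q : {poly R}).

Lemma selfadjoint_opoly A p : selfadjoint ip A -> selfadjoint ip (opoly A p).
Proof.
move=> A_sa; elim/poly_ind: p => [|p a IHp] x y.
  by rewrite opoly0 !zero_lfunE ip0l ip0r.
rewrite opolyD opolyC !add_lfunE !scale_lfunE !id_lfunE !ipE; congr (_ + _).
by rewrite {2}opolyM opolyX opolyMX !comp_lfunE A_sa IHp.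
Qed.

Lemma selfadjoint_kills_linear_factors A (P : pred R) p :
    selfadjoint ip A -> (forall a x, A x = a *: x -> x != 0 -> P a) -> p != 0 ->
  exists s, [/\ uniq s, all P s & forall x, opoly A p x = 0 ->
    opoly A (\prod_(a <- s) ('X - a%:P)) x = 0].
Proof.
move=> A_sa eigP.
have [n] := ubnP (size p); elim: n p => // n IHn p sz_p p_neq0.
have [/eqP/size_poly1P [c c_neq0 ->]|sz1] := eqVneq (size p) 1%N.
  exists [::]; split=> // x; rewrite big_nil -[1]/(1%:P) !opolyC !scale_lfunE.
  by rewrite !id_lfunE => /eqP; rewrite scaler_eq0 (negPf c_neq0) => /eqP ->;
    rewrite scaler0.
have [a [b [q [def_p|[b_neq0 def_p]]]]] := real_quadratic_factor sz1.
  have q_neq0 : q != 0 by apply: contraNneq p_neq0 => q0; rewrite def_p q0 mul0r.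
  have [|s [uniq_s P_s s_q]] := IHn q _ q_neq0.
    by move: sz_p; rewrite def_p size_Mmonic ?monicXsubC // size_XsubC addn2.
  (* Repeated root: (A - a)^2 u = 0 gives |(A - a) u|^2 = 0 by self-adjointness. *)
  have [a_s|a_s] := boolP (a \in s).
    exists s; split=> // x; rewrite def_p opolyM comp_lfunE => /s_q.
    rewrite (big_rem _ a_s) /= -comp_lfunE -opolyM mulrAC -mulrA.
    rewrite 2!opolyM !comp_lfunE.
    rewrite !opoly_XsubC; set u := opoly A _ x; move=> Au.
    apply: (@ip_eq0 _ _ ip); rewrite {1}ipDl ipNl A_sa ipZl -ipZr -ipNr -ipDr Au.
    by rewrite ip0r.
  have [Pa|nPa] := boolP (P a).
    exists (a :: s); split=> [||x]; rewrite ?cons_uniq /= ?a_s ?Pa //.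
    by rewrite def_p opolyM comp_lfunE => /s_q;
      rewrite big_cons mulrC opolyM comp_lfunE.
  (* As [a] fails [P] it is no eigenvalue, so A - a is injective and its factor disappears. *)
  exists s; split=> // x; rewrite def_p mulrC opolyM comp_lfunE opoly_XsubC => Aq.
  apply: s_q; apply: contraNeq nPa; apply: eigP.
  by apply/eqP; rewrite -subr_eq0 Aq.
have q_neq0 : q != 0 by apply: contraNneq p_neq0 => q0; rewrite def_p q0 mulr0.
have [|s [uniq_s P_s s_q]] := IHn q _ q_neq0.
  move: sz_p; rewrite def_p size_mul //; last first.
    by apply: contraNneq p_neq0 => d0; rewrite def_p d0 mul0r.
  rewrite size_polyDl; last first.
    by rewrite size_exp_XsubC (leq_ltn_trans (size_polyC_leq1 _)).
  by rewrite size_exp_XsubC !addSn ltnS => /ltnW.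
(* The quadratic factor is injective: pairing its value at [w] with [w] gives |(A - a) w|^2 + b^2
   |w|^2. *)
exists s; split=> // x; rewrite def_p opolyM comp_lfunE => w0; apply: s_q.
move: w0; set w := opoly A q x => w0; apply: (@ip_eq0 _ _ ip).
move: (congr1 (ip w) w0); rewrite opolyD opolyC opolyM ip0r.
rewrite add_lfunE scale_lfunE id_lfunE comp_lfunE !opoly_XsubC ipDr ipZr.
set v := A w - a *: w.
have -> : ip w (A v - a *: v) = ip v v.
  by rewrite ipDr ipNr ipZr -A_sa -ipZl -ipNl -ipDl.
move=> sum0; have := ip_ge0 ip v; have := ip_ge0 ip w.
have b2 : 0 < b ^+ 2 by rewrite exprn_even_gt0.
by move=> *; nra.
Qed.

(** This replaces diagonalization: being annihilated by a product of distinct linear factors is all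
    that the functional calculus needs. *)
Lemma spectrum_exists A (P : pred R) :
    selfadjoint ip A -> (forall a x, A x = a *: x -> x != 0 -> P a) ->
  exists s, [/\ uniq s, all P s & opoly A (\prod_(a <- s) ('X - a%:P)) = 0].
Proof.
move=> A_sa eigP; have [p p_neq0 Ap0] := exists_annihilating_poly A.
have [s [uniq_s P_s s0]] := selfadjoint_kills_linear_factors A_sa eigP p_neq0.
exists s; split=> //; apply/lfunP => x.
by rewrite [RHS]zero_lfunE s0 // Ap0 zero_lfunE.
Qed.

End SelfAdjoint.

(** * Square roots, inverses and the Loewner order *)

Section FunctionalCalculus.
Variables (R : realType) (X : vectType R) (ip : {dot X for (@idfun R)}).
Implicit Types (A B C T : 'End(X)) (x y z : X) (a : R) (p q : {poly R}).

Lemma psd_selfadjoint A : psd ip A -> selfadjoint ip A.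
Proof. by case. Qed.

Lemma posdef_psd A : posdef ip A -> psd ip A.
Proof.
case=> A_sa A_pos; split=> // x.
by have [->|/A_pos/ltW //] := eqVneq x 0; rewrite ip0l.
Qed.

Lemma psd_eigenvalue_ge0 A a x : psd ip A -> A x = a *: x -> x != 0 -> 0 <= a.
Proof.
move=> [_ A_ge0] Ax x_neq0; have := A_ge0 x.
by rewrite Ax ipZr pmulr_lge0 // ip_gt0.
Qed.

Lemma psd_sqr A : selfadjoint ip A -> psd ip (A \o A)%VF.
Proof.
move=> A_sa; split=> [x y|x]; rewrite !comp_lfunE; first by rewrite !A_sa.
by rewrite -A_sa ip_ge0.
Qed.

(** The root is found as a polynomial in [A], which later keeps it inside [H]. *)
Lemma sqrt_exists A : selfadjoint ip A ->
    (forall a x, A x = a *: x -> x != 0 -> 0 <= a) ->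
  exists p, psd ip (opoly A p) /\ (opoly A p \o opoly A p)%VF = A.
Proof.
move=> A_sa eig_ge0.
have [s [uniq_s s_ge0 As0]] := spectrum_exists (P := fun a => 0 <= a) A_sa eig_ge0.
(* Fourth roots are interpolated, so that [r * r] gives the square root as the square of a
   self-adjoint operator, hence visibly psd. *)
have [r r_s] := interpolation (fun a => Num.sqrt (Num.sqrt a)) uniq_s.
exists (r * r); split.
  by rewrite opolyM; apply: psd_sqr; apply: selfadjoint_opoly.
rewrite -opolyM -[RHS]opolyX; apply: (eq_opoly uniq_s As0) => a a_s.
rewrite !hornerM hornerX r_s //.
have -> : Num.sqrt (Num.sqrt a) * Num.sqrt (Num.sqrt a) = Num.sqrt a.
  by rewrite -expr2 sqr_sqrtr ?sqrtr_ge0.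
by rewrite -expr2 sqr_sqrtr // (allP s_ge0).
Qed.

Lemma psd_eigenvalues A : selfadjoint ip A ->
  (forall a x, A x = a *: x -> x != 0 -> 0 <= a) -> psd ip A.
Proof.
move=> A_sa /(sqrt_exists A_sa) [p [[p_sa _] <-]]; exact: psd_sqr.
Qed.

Lemma opoly_comp_sqr A p : opoly (A \o A)%VF p = opoly A (p \Po 'X^2).
Proof.
elim/poly_ind: p => [|p a IHp]; first by rewrite comp_poly0 !opoly0.
rewrite comp_polyD comp_polyM comp_polyX comp_polyC !opolyD !opolyC opolyMX IHp.
by rewrite expr2 mulrA !opolyMX comp_lfunA.
Qed.

(** A single polynomial [r], interpolating the square root at the squares of both spectra, recovers
    each operator from its square. *)
Lemma psd_sqr_inj A B : psd ip A -> psd ip B ->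
  (A \o A)%VF = (B \o B)%VF -> A = B.
Proof.
move=> A_psd B_psd eq_AB.
have [s [us s_ge0 As0]] := spectrum_exists (P := fun a => 0 <= a)
  (psd_selfadjoint A_psd) (fun a x => psd_eigenvalue_ge0 A_psd).
have [t [ut t_ge0 Bt0]] := spectrum_exists (P := fun a => 0 <= a)
  (psd_selfadjoint B_psd) (fun a x => psd_eigenvalue_ge0 B_psd).
have [r r_s] := interpolation (@Num.sqrt R) (undup_uniq [seq a ^+ 2 | a <- s ++ t]).
have sqrtK u C : uniq u -> all (fun a => 0 <= a) u -> {subset u <= s ++ t} ->
    opoly C (\prod_(a <- u) ('X - a%:P)) = 0 -> C = opoly (C \o C)%VF r.
  move=> uniq_u u_ge0 u_st Cu0; rewrite opoly_comp_sqr -[LHS]opolyX.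
  apply: (eq_opoly uniq_u Cu0) => a a_u; rewrite hornerX horner_comp hornerXn r_s.
    by rewrite sqrtr_sqr ger0_norm //; apply: (allP u_ge0 a a_u).
  by rewrite mem_undup (map_f (fun a => a ^+ 2)) ?u_st.
rewrite (sqrtK s A) //; last by move=> a a_s; rewrite mem_cat a_s.
by rewrite eq_AB -(sqrtK t B) // => a a_t; rewrite mem_cat a_t orbT.
Qed.

Lemma opsqrt_sqr B : psd ip B -> opsqrt ip (B \o B)%VF = B.
Proof.
move=> B_psd; rewrite /opsqrt; case: xgetP => [C _ [C_psd CC]|/(_ B) []//].
exact: psd_sqr_inj.
Qed.

Lemma opsqrt_poly A : psd ip A -> exists p, opsqrt ip A = opoly A p.
Proof.
move=> A_psd; have [p [p_psd pp]] := sqrt_exists (psd_selfadjoint A_psd)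
  (fun a x => psd_eigenvalue_ge0 A_psd).
by exists p; rewrite -[in LHS]pp opsqrt_sqr.
Qed.

Lemma psd_opsqrt A : psd ip A -> psd ip (opsqrt ip A).
Proof.
move=> A_psd; have [p [p_psd pp]] := sqrt_exists (psd_selfadjoint A_psd)
  (fun a x => psd_eigenvalue_ge0 A_psd).
by rewrite -[A]pp opsqrt_sqr.
Qed.

Lemma opsqrtK A : psd ip A -> (opsqrt ip A \o opsqrt ip A)%VF = A.
Proof.
move=> A_psd; have [p [p_psd pp]] := sqrt_exists (psd_selfadjoint A_psd)
  (fun a x => psd_eigenvalue_ge0 A_psd).
by rewrite -[in LHS]pp opsqrt_sqr.
Qed.

(** With Q the square root of [A], <x, A x> = |Q x|^2. *)
Lemma psd_ker A x : psd ip A -> ip x (A x) = 0 -> A x = 0.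
Proof.
move=> A_psd Ax0; have [Q_sa _] := psd_opsqrt A_psd.
rewrite -(opsqrtK A_psd) comp_lfunE.
have -> : opsqrt ip A x = 0; last by rewrite linear0.
by apply: (@ip_eq0 _ _ ip); rewrite Q_sa -comp_lfunE opsqrtK.
Qed.

Lemma posdef_ker A x : posdef ip A -> A x = 0 -> x = 0.
Proof.
move=> [_ A_pos] Ax0; apply/eqP; apply: contraT => /A_pos.
by rewrite Ax0 ip0r ltxx.
Qed.

Lemma posdef_of_ker A : psd ip A -> (forall x, A x = 0 -> x = 0) -> posdef ip A.
Proof.
move=> A_psd A_inj; split=> [|x x_neq0]; first by case: A_psd.
rewrite lt_neqAle (proj2 A_psd) andbT eq_sym.
by apply: contraNneq x_neq0 => /(psd_ker A_psd)/A_inj ->.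
Qed.

Lemma posdef_opsqrt A : posdef ip A -> posdef ip (opsqrt ip A).
Proof.
move=> A_pos; apply: posdef_of_ker; first exact/psd_opsqrt/posdef_psd.
move=> x Bx0; apply: (posdef_ker A_pos).
by rewrite -(opsqrtK (posdef_psd A_pos)) comp_lfunE Bx0 linear0.
Qed.

Lemma posdef_lker A : posdef ip A -> lker A == 0%VS.
Proof.
move=> A_pos; apply/lker0P => x y Axy; apply/eqP; rewrite -subr_eq0; apply/eqP.
by apply: (posdef_ker A_pos); rewrite linearB /= Axy subrr.
Qed.

Lemma posdef_compVf A : posdef ip A -> (A^-1 \o A)%VF = \1%VF.
Proof. by move/posdef_lker/lker0_compVf. Qed.

Lemma posdef_compfV A : posdef ip A -> (A \o A^-1)%VF = \1%VF.
Proof. by move/posdef_lker/lker0_compfV. Qed.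

Lemma posdef_invK A x : posdef ip A -> A (A^-1%VF x) = x.
Proof. by move=> A_pos; rewrite -comp_lfunE posdef_compfV // id_lfunE. Qed.

Lemma posdef_inv A : posdef ip A -> posdef ip (A^-1)%VF.
Proof.
move=> A_pos; have [A_sa A_gt0] := A_pos; split=> [x y|x x_neq0].
  by rewrite -{1}(posdef_invK y A_pos) -A_sa posdef_invK.
rewrite -{1}(posdef_invK x A_pos) A_sa A_gt0 //.
by apply: contraNneq x_neq0 => Vx0; rewrite -(posdef_invK x A_pos) Vx0 linear0.
Qed.

(** Interpolating 1/a on the positive spectrum gives a left inverse of [A]; as a polynomial in [A],
    it stays inside [H]. *)
Lemma posdef_inv_poly A : posdef ip A -> exists p, (A^-1)%VF = opoly A p.
Proof.
move=> A_pos; have [A_sa A_gt0] := A_pos.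
have eig_gt0 a x : A x = a *: x -> x != 0 -> 0 < a.
  by move=> Ax x0; have := A_gt0 x x0; rewrite Ax ipZr pmulr_lgt0 // ip_gt0.
have [s [uniq_s s_gt0 As0]] := spectrum_exists (P := fun a => 0 < a) A_sa eig_gt0.
have [r r_s] := interpolation (fun a => a^-1) uniq_s; exists r.
have rA : (opoly A r \o A)%VF = \1%VF.
  rewrite -[X in (_ \o X)%VF]opolyX -opolyM -[RHS]scale1r -(opolyC A).
  apply: (eq_opoly uniq_s As0) => a a_s.
  rewrite hornerM hornerX hornerC r_s // mulVf //.
  by apply: lt0r_neq0; apply: (allP s_gt0 a a_s).
by rewrite -[LHS]comp_lfun1l -rA -comp_lfunA posdef_compfV // comp_lfun1r.
Qed.

Lemma psdD A B : psd ip A -> psd ip B -> psd ip (A + B).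
Proof.
move=> [A_sa A_ge0] [B_sa B_ge0]; split=> [x y|x]; rewrite !add_lfunE !ipE.
  by rewrite A_sa B_sa.
exact: addr_ge0.
Qed.

Lemma posdefDl A B : psd ip A -> posdef ip B -> posdef ip (A + B).
Proof.
move=> A_psd B_pos; have [AB_sa _] := psdD A_psd (posdef_psd B_pos).
split=> // x /(proj2 B_pos); rewrite add_lfunE ipDr => Bx.
by rewrite ltr_wpDl // (proj2 A_psd).
Qed.

Lemma psdZ a A : 0 <= a -> psd ip A -> psd ip (a *: A).
Proof.
move=> a_ge0 [A_sa A_ge0]; split=> [x y|x]; rewrite !scale_lfunE !ipE ?A_sa //.
exact: mulr_ge0.
Qed.

Lemma selfadjointB A B :
  selfadjoint ip A -> selfadjoint ip B -> selfadjoint ip (A - B).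
Proof.
by move=> A_sa B_sa x y; rewrite !add_lfunE !opp_lfunE !ipE A_sa B_sa.
Qed.

Lemma psd_conj A B : selfadjoint ip B -> psd ip A -> psd ip (B \o A \o B)%VF.
Proof.
move=> B_sa [A_sa A_ge0]; split=> [x y|x]; rewrite !comp_lfunE.
  by rewrite B_sa A_sa B_sa.
by rewrite -B_sa.
Qed.

(** It suffices that every eigenvalue a of the difference of the roots is nonnegative. For an
    eigenvector x, <x, (B - A) x> is a times the sum of <x, sqrt B x> and <x, sqrt A x>, which is
    positive. *)
Lemma opsqrt_le A B : posdef ip A -> posdef ip B ->
  loewner_le ip A B -> loewner_le ip (opsqrt ip A) (opsqrt ip B).
Proof.
move=> A_pos B_pos [_ leAB].
have QA_pos := posdef_opsqrt A_pos; have QB_pos := posdef_opsqrt B_pos.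
have [QA_sa QA_gt0] := QA_pos; have [QB_sa QB_gt0] := QB_pos.
apply: psd_eigenvalues => [|a x]; first exact: selfadjointB.
rewrite add_lfunE opp_lfunE => Qx x_neq0; have := leAB x.
rewrite -{1}(opsqrtK (posdef_psd A_pos)) -{1}(opsqrtK (posdef_psd B_pos)).
have {Qx} Qx : opsqrt ip B x = a *: x + opsqrt ip A x by rewrite -Qx subrK.
rewrite add_lfunE opp_lfunE !comp_lfunE ipDr ipNr -QA_sa -QB_sa.
have QAx := QA_gt0 x x_neq0; have := QB_gt0 x x_neq0.
rewrite Qx !ipE (ipC ip (opsqrt ip A x) x) => QBx.
set u := ip x x in QBx *; set v := ip x (opsqrt ip A x) in QAx QBx *.
set w := ip _ _ => le0; have {le0} : 0 <= a * (a * u + v + v) by move: le0; lra.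
by rewrite pmulr_lge0 //; lra.
Qed.

(** With z = A^-1 x and y = B^-1 x, expand 0 <= <z - y, A (z - y)> and bound <y, A y> by <y, B y> =
    <y, x>. *)
Lemma inv_le A B : posdef ip A -> posdef ip B ->
  loewner_le ip A B -> loewner_le ip (B^-1)%VF (A^-1)%VF.
Proof.
move=> A_pos B_pos [_ leAB].
have [VA_sa _] := posdef_inv A_pos; have [VB_sa _] := posdef_inv B_pos.
split=> [|x]; first exact: selfadjointB.
have [A_sa _] := A_pos.
set y := (B^-1)%VF x; have := leAB y; set z := (A^-1)%VF x.
have := proj2 (posdef_psd A_pos) (z - y).
rewrite add_lfunE opp_lfunE -/y -/z linearB /= posdef_invK //.
rewrite add_lfunE opp_lfunE posdef_invK // !ipE.
have -> : ip z (A y) = ip x y by rewrite -A_sa posdef_invK.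
rewrite (ipC ip z x) (ipC ip y x); lra.
Qed.

End FunctionalCalculus.

(** * Traces, and the projection onto H *)

Section Traces.
Variables (R : realType) (X : vectType R) (ip : {dot X for (@idfun R)}).
Implicit Types (A B C E T : 'End(X)) (x y z : X) (a : R) (s : seq 'End(X)).

(** A named form of the rank-one map, to which a linear structure can be attached so that [lfunE]
    computes [out]. *)
Definition out_fun z x := ip z x *: z.

Lemma out_fun_linear z : linear (out_fun z).
Proof.
by move=> a x y; rewrite /out_fun ipDr ipZr scalerDl scalerA.
Qed.

HB.instance Definition _ z := GRing.isLinear.Build R X X *:%R (out_fun z)
  (out_fun_linear z).

Lemma outE z x : out ip z x = ip z x *: z.
Proof. by rewrite /out -[fun _ => _]/(out_fun z) lfunE. Qed.

Lemma psd_out m : psd ip (out ip m).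
Proof.
split=> [x y|x]; rewrite !outE !ipE; last by rewrite ipC -expr2 sqr_ge0.
by rewrite (ipC ip x m) mulrC.
Qed.

Lemma cauchy_schwarz x y : ip x y ^+ 2 <= ip x x * ip y y.
Proof.
have [->|y_neq0] := eqVneq y 0; first by rewrite !ip0r expr0n mulr0.
have y_gt0 := ip_gt0 ip y_neq0.
have := ip_ge0 ip (ip y y *: x - ip x y *: y).
rewrite !ipE (ipC ip y x) => sq_ge0.
have : 0 <= ip y y * (ip x x * ip y y - ip x y ^+ 2) by move: sq_ge0; lra.
by rewrite pmulr_rge0 // subr_ge0.
Qed.

Lemma optrace_out T z : optrace (out ip z \o T)%VF = ip z (T z).
Proof.
rewrite optraceC; apply: (optrace_rank1 (ip := ip)) => x.
by rewrite comp_lfunE outE linearZ.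
Qed.

Lemma optrace_frame : exists n (e : 'I_n -> X),
  (forall x, x = \sum_i ip (e i) x *: e i) /\
  forall T, optrace T = \sum_i ip (e i) (T (e i)).
Proof.
have [n [e e_frame]] := frame_exists ip; exists n, e; split=> // T.
have {1}-> : T = \sum_i (out ip (e i) \o T)%VF.
  apply/lfunP => x; rewrite sum_lfunE [LHS]e_frame.
  by apply: eq_bigr => i _; rewrite comp_lfunE outE.
rewrite (big_morph (@optrace R X) (@optraceD R X) (@optrace0 R X)).
by apply: eq_bigr => i _; rewrite optrace_out.
Qed.

Lemma optrace_ge0 T : psd ip T -> 0 <= optrace T.
Proof.
have [n [e [_ trE]]] := optrace_frame.
by move=> [_ T_ge0]; rewrite trE sumr_ge0.
Qed.

(** With Q the square root of [B], the trace equals that of Q A Q. *)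
Lemma optrace_comp_ge0 A B : psd ip A -> psd ip B -> 0 <= optrace (A \o B)%VF.
Proof.
move=> A_psd B_psd; rewrite -(opsqrtK B_psd) comp_lfunA optraceC comp_lfunA.
by apply/optrace_ge0/psd_conj => //; case: (psd_opsqrt B_psd).
Qed.

(** The trace is the sum of the |E e_i|^2 over a frame. This makes the trace form definite on
    [H]. *)
Lemma optrace_sqr_eq0 E : selfadjoint ip E -> optrace (E \o E)%VF = 0 -> E = 0.
Proof.
move=> E_sa; have [n [e [e_frame ->]]] := optrace_frame => sum0.
have Ee0 i : E (e i) = 0.
  apply: (@ip_eq0 _ _ ip); rewrite E_sa -comp_lfunE.
  by apply: (psumr_eq0P _ sum0) => // j _; exact: (proj2 (psd_sqr E_sa)).
apply/lfunP => x; rewrite [x]e_frame linear_sum zero_lfunE big1 // => i _.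
by rewrite linearZ /= Ee0 scaler0.
Qed.

Lemma ip_le_optrace T x : psd ip T -> ip x (T x) <= optrace T * ip x x.
Proof.
move=> T_psd.
have K_psd : psd ip (ip x x *: \1%VF - out ip x).
  split=> [y z|y]; rewrite !add_lfunE !opp_lfunE !scale_lfunE !id_lfunE !outE.
    by rewrite !ipE (ipC ip y x); lra.
  by rewrite !ipE (ipC ip y x) -expr2 subr_ge0 cauchy_schwarz.
have := optrace_comp_ge0 K_psd T_psd.
by rewrite !optrace_bilin comp_lfun1l optrace_out subr_ge0 mulrC.
Qed.

Lemma adjoint_selfadjoint A : selfadjoint ip A -> adjoint ip A = A.
Proof.
move=> A_sa; rewrite /adjoint; case: xgetP => [B _ B_adj|/(_ A)]; last by [].
apply/lfunP => y; apply/eqP; rewrite -subr_eq0; apply/eqP.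
by apply: (@ip_eq0 _ _ ip); rewrite ipDr ipNr -B_adj -A_sa subrr.
Qed.

Lemma trnorm_psd A : psd ip A -> trnorm ip A = optrace A.
Proof.
move=> A_psd; rewrite /trnorm adjoint_selfadjoint; last by case: A_psd.
by rewrite opsqrt_sqr.
Qed.

End Traces.

Section Projection.
Variables (R : realType) (X : vectType R) (ip : {dot X for (@idfun R)}).
Variables (H : {vspace 'End(X)}).
Hypothesis H_sa : forall A, A \in H -> selfadjoint ip A.
Implicit Types (A B C : 'End(X)) (s : seq 'End(X)).

(** Gram-Schmidt for the trace form: the induction hypothesis serves both [A] and the new generator
    [E], whose residual [G] is orthogonal to the earlier span. *)
Lemma projection_exists A s : {subset s <= H} ->
  exists2 B, B \in <<s>>%VS &
    forall C, C \in <<s>>%VS -> optrace ((A - B) \o C)%VF = 0.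
Proof.
elim: s A => [|E s IHs] A s_H.
  by exists 0; rewrite ?mem0v // => C; rewrite span_nil memv0 => /eqP ->;
    rewrite comp_lfun0r optrace0.
have [|B0 B0s A_B0] := IHs A.
  by move=> C Cs; apply: s_H; rewrite in_cons Cs orbT.
have [|F Fs E_F] := IHs E.
  by move=> C Cs; apply: s_H; rewrite in_cons Cs orbT.
have H_span C : C \in <<s>>%VS -> C \in H.
  move=> Cs; apply: (subvP _ _ Cs); apply/span_subvP => D Ds.
  by apply: s_H; rewrite in_cons Ds orbT.
pose G := E - F.
have G_sa : selfadjoint ip G.
  by apply: H_sa; apply: memvB; [apply: s_H; exact: mem_head|exact: H_span].
have span_split C : C \in <<E :: s>>%VS ->
    exists k C', C' \in <<s>>%VS /\ C = k *: G + C'.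
  rewrite span_cons => /memv_addP [_ /vlineP [k ->] [C' C's ->]].
  exists k, (k *: F + C'); split; first by rewrite memvD ?memvZ.
  by rewrite addrA -scalerDr subrK.
have G_s C : C \in <<s>>%VS -> optrace (G \o C)%VF = 0 by exact: E_F.
have s_Es C : C \in <<s>>%VS -> C \in <<E :: s>>%VS.
  by rewrite span_cons => Cs; rewrite -[C]add0r memv_add ?mem0v.
have G_Es : G \in <<E :: s>>%VS.
  exact: memvB (memv_span (mem_head _ _)) (s_Es _ Fs).
clearbody G; pose t := optrace (A \o G)%VF / optrace (G \o G)%VF.
exists (B0 + t *: G) => [|C]; first exact: memvD (s_Es _ B0s) (memvZ _ G_Es).
move=> /span_split [k [C' [C's ->]]].
have G_C' : optrace (G \o C')%VF = 0 by apply: G_s.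
have B0_G : optrace (B0 \o G)%VF = 0 by rewrite optraceC G_s.
have := A_B0 _ C's; rewrite !optrace_bilin G_C' B0_G => A_C'.
(* A zero denominator in [t] is harmless: then [G] itself is 0. *)
have [G0|G_neq0] := eqVneq (optrace (G \o G)%VF) 0.
  have G_eq0 := optrace_sqr_eq0 G_sa G0.
  move: A_C'; rewrite G_eq0 !comp_lfun0r optrace0; lra.
have tG : t * optrace (G \o G)%VF = optrace (A \o G)%VF by rewrite divfK.
by rewrite tG; move: A_C'; lra.
Qed.

Lemma opip_selfadjoint A C : selfadjoint ip C -> opip ip A C = optrace (A \o C)%VF.
Proof. by move=> C_sa; rewrite /opip adjoint_selfadjoint. Qed.

(** Existence rules out the default value of [xget]; self-adjointness of the test operators removes
    the adjoint from [opip]. *)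
Lemma orthprojP A : orthproj ip H A \in H /\
  forall C, C \in H -> optrace (orthproj ip H A \o C)%VF = optrace (A \o C)%VF.
Proof.
rewrite /orthproj; case: xgetP => [B _ [B_H A_B]|no_proj].
  split=> // C C_H; have := A_B C C_H; rewrite opip_selfadjoint; last exact: H_sa.
  by rewrite !optrace_bilin; lra.
have [B B_H A_B] := @projection_exists A (vbasis H) (fun C => @vbasis_mem _ _ C H).
case: (no_proj B); move: B_H A_B; rewrite (span_basis (vbasisP H)) => B_H A_B.
by split=> // C C_H; rewrite opip_selfadjoint ?A_B //; apply: H_sa.
Qed.

Lemma orthproj_eq A B : B \in H ->
  (forall C, C \in H -> optrace (B \o C)%VF = optrace (A \o C)%VF) ->
  orthproj ip H A = B.
Proof.
move=> B_H B_A; have [P_H P_A] := orthprojP A.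
apply/eqP; rewrite -subr_eq0; apply/eqP; set D := _ - B.
have D_orth C : C \in H -> optrace (D \o C)%VF = 0.
  by move=> C_H; rewrite /D !optrace_bilin P_A // B_A // subrr.
have D_H : D \in H by rewrite memvB.
by apply: (optrace_sqr_eq0 (H_sa D_H)); exact: D_orth.
Qed.

(** Since I is in [H], projecting A + eps I adds eps I to the projection. Were the form of the
    projection negative at x, the chosen [eps] would make the perturbed form exactly 0 there,
    against positive definiteness. *)
Lemma psd_orthproj A : \1%VF \in H ->
    (forall B, posdef ip B -> posdef ip (orthproj ip H B)) ->
  psd ip A -> psd ip (orthproj ip H A).
Proof.
move=> H_id H_proj A_psd; have [P_H P_A] := orthprojP A.
split=> [|x]; first exact: H_sa.
have [->|x_neq0] := eqVneq x 0; first by rewrite ip0l.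
have x_gt0 := ip_gt0 ip x_neq0.
rewrite leNgt; apply/negP => Px_lt0.
pose eps := - ip x (orthproj ip H A x) / ip x x.
have eps_gt0 : 0 < eps by rewrite divr_gt0 // oppr_gt0.
have : posdef ip (orthproj ip H (A + eps *: \1%VF)).
  apply/H_proj/posdefDl => //; split=> [y z|y y_neq0].
    by rewrite !scale_lfunE !id_lfunE !ipE.
  by rewrite scale_lfunE id_lfunE ipZr mulr_gt0 ?ip_gt0.
rewrite (@orthproj_eq _ (orthproj ip H A + eps *: \1%VF)).
- case=> _ /(_ x x_neq0); rewrite add_lfunE scale_lfunE id_lfunE ipDr ipZr.
  by rewrite divfK ?gt_eqF // subrr ltxx.
- by rewrite memvD ?memvZ.
- by move=> C C_H; rewrite !optrace_bilin P_A.
Qed.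

End Projection.

(** * The trace of the square root *)

(** Eliminates u: s^2 <= b^2 u^2 <= b^2 c s, then divide by s. *)
Lemma le_of_sqr_le (R : realFieldType) (b s u c : R) :
  0 <= s -> 0 <= c -> s <= b * u -> u ^+ 2 <= c * s -> s <= b ^+ 2 * c.
Proof.
move=> s_ge0 c_ge0 s_bu u2.
have [->|s_neq0] := eqVneq s 0; first exact: mulr_ge0 (sqr_ge0 b) c_ge0.
have s_gt0 : 0 < s by rewrite lt_neqAle eq_sym s_neq0.
rewrite -(ler_pM2l s_gt0) -expr2 mulrC -mulrA.
apply: le_trans (ler_wpM2l (sqr_ge0 b) u2).
by rewrite -exprMn lerXn2r // nnegrE // (le_trans s_ge0).
Qed.

Lemma half_diff_le (R : realFieldType) (p q r b c e : R) :
  0 <= q -> q <= b * e -> 0 <= r ->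
  r <= c * e -> `|(2 * p + q - r) / 2 - p| <= (b + c) * e.
Proof. by move=> *; rewrite ler_norml; apply/andP; split; lra. Qed.

Section TraceSqrt.
Variables (R : realType) (X : vectType R) (ip : {dot X for (@idfun R)}).
Implicit Types (A B C E M S V : 'End(X)) (x y z : X) (a : R).

Lemma optrace_rot A B C : optrace (A \o B \o C)%VF = optrace (C \o A \o B)%VF.
Proof. by rewrite optraceC comp_lfunA. Qed.

(** With E = C - B, C^2 - B^2 = B E + E B + E^2; composing with B^-1 and taking traces gives 2 tr E
    + tr (E B^-1 E). *)
Lemma optrace_expand B C : posdef ip B ->
  optrace C - optrace B =
    (optrace ((C \o C - (B \o B)) \o B^-1)%VF
     - optrace ((C - B) \o B^-1 \o (C - B))%VF) / 2.
Proof.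
move=> B_pos; rewrite !(comp_lfunDl, comp_lfunDr, comp_lfunNl, comp_lfunNr).
rewrite !(optraceD, optraceN) -[(C \o B^-1 \o B)%VF]comp_lfunA (posdef_compVf B_pos).
rewrite -[(B \o B \o B^-1)%VF]comp_lfunA (posdef_compfV B_pos).
rewrite comp_lfun1r comp_lfun1l.
by rewrite (optrace_rot C (B^-1)%VF C) comp_lfun1r comp_lfun1l; lra.
Qed.

(** The tangent inequality of the concave function tr sqrt, at B^2: the second-order term of
    [optrace_expand] has a sign. *)
Lemma optrace_sqrt_le B C : posdef ip B -> psd ip C ->
  optrace C <= optrace B + optrace ((C \o C - (B \o B)) \o B^-1)%VF / 2.
Proof.
move=> B_pos C_psd; have := optrace_expand C B_pos.
have V_psd := posdef_psd (posdef_inv B_pos).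
have [B_sa _] := B_pos; have [C_sa _] := C_psd.
have := optrace_ge0 (psd_conj (selfadjointB C_sa B_sa) V_psd).
lra.
Qed.

(** With E = C - B, this is E C + B E = C^2 - B^2 multiplied by E under the trace. *)
Lemma optrace_sylvester B C :
  optrace ((C - B) \o C \o (C - B))%VF + optrace ((C - B) \o B \o (C - B))%VF =
  optrace ((C \o C - (B \o B)) \o (C - B))%VF.
Proof.
rewrite !(comp_lfunDl, comp_lfunDr, comp_lfunNl, comp_lfunNr).
rewrite !(optraceD, optraceN).
rewrite (optrace_rot B C C) (optrace_rot C B C).
rewrite (optrace_rot B C B) (optrace_rot B B C).
lra.
Qed.

Lemma psd_inv_bound B b : posdef ip B -> 0 < b ->
  (forall x, ip x (B^-1%VF x) <= b * ip x x) -> psd ip (b *: B - \1%VF).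
Proof.
move=> B_pos b_gt0 V_le; have [B_sa _] := B_pos.
split=> [x y|x]; first rewrite !add_lfunE !opp_lfunE.
  by rewrite !scale_lfunE !id_lfunE !ipE B_sa.
(* This vector yields b^2 <x, B x> - 2 b |x|^2 + <x, B^-1 x> >= 0; bounding the last term by b |x|^2
   leaves a multiple of b. *)
have := proj2 (posdef_psd B_pos) (b *: x - B^-1%VF x).
rewrite linearB linearZ /= (posdef_invK _ B_pos) !ipE.
have -> : ip (B^-1%VF x) (B x) = ip x x by rewrite -B_sa (posdef_invK _ B_pos).
have := V_le x; rewrite (ipC ip _ x) add_lfunE opp_lfunE scale_lfunE id_lfunE.
rewrite !ipE => le1 le2.
have : 0 <= b * (b * ip x (B x) - ip x x) by move: le1 le2; lra.
by rewrite pmulr_rge0.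
Qed.

Lemma optrace_conj_le V E b : psd ip (b *: \1%VF - V) -> selfadjoint ip E ->
  optrace (E \o V \o E)%VF <= b * optrace (E \o E)%VF.
Proof.
move=> bV E_sa; have := optrace_comp_ge0 bV (psd_sqr E_sa).
by rewrite !optrace_bilin comp_lfun1l subr_ge0 comp_lfunA optraceC comp_lfunA.
Qed.

Lemma optrace_conj_ge B E b : psd ip (b *: B - \1%VF) -> selfadjoint ip E ->
  optrace (E \o E)%VF <= b * optrace (E \o B \o E)%VF.
Proof.
move=> bB E_sa; have := optrace_comp_ge0 bB (psd_sqr E_sa).
by rewrite !optrace_bilin comp_lfun1l subr_ge0 comp_lfunA optraceC comp_lfunA.
Qed.

Lemma ip_quadratic_diff E x h : selfadjoint ip E ->
  ip (x + h) (E (x + h)) - ip x (E x) = 2 * ip x (E h) + ip h (E h).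
Proof.
move=> E_sa; have E_C : ip h (E x) = ip x (E h) by rewrite -E_sa ipC.
by rewrite !(linearD E) !ipE E_C; lra.
Qed.

Lemma ip_quadratic_diff_mid E x h : selfadjoint ip E ->
  ip (x + h) (E (x + h)) - ip x (E x) = ip h (E (x + x + h)).
Proof.
move=> E_sa; have E_C : ip x (E h) = ip h (E x) by rewrite -E_sa ipC.
by rewrite ip_quadratic_diff // !(linearD E) !ipE E_C; lra.
Qed.

Lemma ip_double_le x h : ip (x + x + h) (x + x + h) <= 8 * ip x x + 2 * ip h h.
Proof. by have := ip_ge0 ip (x + x - h); rewrite !ipE (ipC ip h x); lra. Qed.

(* The derivative of the trace of the square root is avoided: concavity bounds
   the increments over [k / n, (k + 1) / n], the bounds telescope to O(1 / n). *)
Lemma optrace_sqrt_diff_le M S S' : psd ip M -> posdef ip S -> posdef ip S' ->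
    loewner_le ip S S' ->
  optrace (opsqrt ip (M + S')) - optrace (opsqrt ip (M + S)) <=
  optrace (opsqrt ip S') - optrace (opsqrt ip S).
Proof.
move=> M_psd S_pos S'_pos leSS'.
pose B C t := opsqrt ip (t *: M + C).
have A_pos C t : 0 <= t -> posdef ip C -> posdef ip (t *: M + C).
  by move=> t_ge0; apply: posdefDl; apply: psdZ.
have BB C t : 0 <= t -> posdef ip C -> (B C t \o B C t)%VF = t *: M + C.
  by move=> t_ge0 C_pos; apply/opsqrtK/posdef_psd/A_pos.
have B_pos C t : 0 <= t -> posdef ip C -> posdef ip (B C t).
  by move=> t_ge0 C_pos; apply/posdef_opsqrt/A_pos.
pose phi t := optrace (B S' t) - optrace (B S t).
pose psi t := optrace (M \o (B S t)^-1)%VF.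
have psi_ge0 t : 0 <= t -> 0 <= psi t.
  by move=> t_ge0; apply/optrace_comp_ge0/posdef_psd/posdef_inv/B_pos.
(* Tangent inequalities are taken at [t] for [S'] and at [t + u] for [S]; antitonicity of the
   inverse then replaces [S'] by [S], so that the bound telescopes. *)
have step t u : 0 <= t -> 0 <= u ->
    phi (t + u) - phi t <= u / 2 * (psi t - psi (t + u)).
  move=> t_ge0 u_ge0; have tu_ge0 : 0 <= t + u by exact: addr_ge0.
  have up := optrace_sqrt_le (B_pos S' t t_ge0 S'_pos)
    (posdef_psd (B_pos S' (t + u) tu_ge0 S'_pos)).
  have lo := optrace_sqrt_le (B_pos S (t + u) tu_ge0 S_pos)
    (posdef_psd (B_pos S t t_ge0 S_pos)).
  have inv_anti : optrace (M \o (B S' t)^-1)%VF <= psi t.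
    have := optrace_comp_ge0 M_psd (inv_le (B_pos S t t_ge0 S_pos)
      (B_pos S' t t_ge0 S'_pos) _).
    rewrite !optrace_bilin subr_ge0; apply; apply: opsqrt_le; try exact: A_pos.
    suff -> : loewner_le ip (t *: M + S) (t *: M + S') = loewner_le ip S S' by [].
    by rewrite /loewner_le opprD addrACA subrr add0r.
  move: up lo; rewrite !BB // !optrace_bilin -/(psi (t + u)) /phi.
  have : 0 <= u / 2 * (psi t - optrace (M \o (B S' t)^-1)%VF).
    by rewrite mulr_ge0 ?subr_ge0 // divr_ge0.
  by rewrite /psi; lra.
have bound n : phi 1 - phi 0 <= psi 0 / 2 / n.+1%:R.
  pose u : R := n.+1%:R^-1.
  have u_ge0 : 0 <= u by rewrite invr_ge0.
  have tele k : phi (k%:R * u) - phi 0 <= u / 2 * (psi 0 - psi (k%:R * u)).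
    elim: k => [|k IHk]; first by rewrite mul0r !subrr mulr0.
    have := step (k%:R * u) u (mulr_ge0 (ler0n _ _) u_ge0) u_ge0.
    have -> : k%:R * u + u = k.+1%:R * u by rewrite -natr1 mulrDl mul1r.
    lra.
  have := tele n.+1; rewrite mulfV ?pnatr_eq0 // => tele_n.
  have := mulr_ge0 u_ge0 (psi_ge0 1 ler01); rewrite -/u; lra.
(* The number of intervals tends to infinity, by the Archimedean property. *)
have phi_le : phi 1 <= phi 0.
  rewrite leNgt; apply/negP; rewrite -subr_gt0 => gap.
  have psi0_ge0 : 0 <= psi 0 / 2 by rewrite divr_ge0 // psi_ge0.
  have := archi_boundP (divr_ge0 psi0_ge0 (ltW gap)).
  set N := Num.bound _; rewrite ltr_pdivrMr // => N_gt; have := bound N.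
  by rewrite ler_pdivlMr ?ltr0Sn // -natr1; lra.
by move: phi_le; rewrite /phi /B !scale1r !scale0r !add0r.
Qed.

Lemma optrace_inv_diff_le M B0 B1 (D := (B1^-1)%VF - (B0^-1)%VF) :
    posdef ip B0 -> posdef ip B1 -> loewner_le ip B0 B1 ->
    psd ip ((B0 \o B0)%VF - M) ->
  optrace (M \o (D \o B1 \o D))%VF <= optrace B1 - optrace B0.
Proof.
move=> B0_pos B1_pos leB A0M.
have D_sa : selfadjoint ip D.
  by apply: selfadjointB; [case: (posdef_inv B1_pos)|case: (posdef_inv B0_pos)].
have := optrace_comp_ge0 A0M (psd_conj D_sa (posdef_psd B1_pos)).
rewrite optrace_compDl optrace_compNl subr_ge0 => /le_trans; apply.
have B0_sa := psd_selfadjoint (posdef_psd B0_pos).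
(* This is tr (B0 B1^-1 B0) <= tr B0. *)
have := optrace_ge0 (psd_conj B0_sa (inv_le B0_pos B1_pos leB)).
have -> : (D \o B1 \o D)%VF =
    (B1^-1)%VF - (B0^-1)%VF - (B0^-1)%VF + (B0^-1 \o B1 \o B0^-1)%VF.
  rewrite /D !(comp_lfunDl, comp_lfunDr, comp_lfunNl, comp_lfunNr).
  rewrite (posdef_compVf B1_pos) !comp_lfun1l.
  rewrite -[(B0^-1 \o B1 \o B1^-1)%VF]comp_lfunA (posdef_compfV B1_pos) comp_lfun1r.
  by rewrite opprK addrA.
have V0_cancel : (B0 \o B0 \o B0^-1)%VF = B0.
  by rewrite -comp_lfunA (posdef_compfV B0_pos) comp_lfun1r.
rewrite !(comp_lfunDl, comp_lfunDr, comp_lfunNl, comp_lfunNr).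
rewrite !(optraceD, optraceN) !comp_lfunA V0_cancel.
rewrite (optrace_rot B0 _ B0) V0_cancel (optrace_rot B0 (B1^-1)%VF B0).
rewrite (optrace_rot B0 B1) (posdef_compVf B0_pos) comp_lfun1l; lra.
Qed.

End TraceSqrt.

(** * The gradient of the potential *)

Section Gradient.
Variables (R : realType) (X : vectType R) (ip : {dot X for (@idfun R)}).
Implicit Types (f : X -> R) (x g h : X).

Lemma enorm_ge0 x : 0 <= enorm ip x.
Proof. exact: sqrtr_ge0. Qed.

Lemma enorm_sqr x : enorm ip x ^+ 2 = ip x x.
Proof. by rewrite sqr_sqrtr // ip_ge0. Qed.

Lemma enormZ a x : enorm ip (a *: x) = `|a| * enorm ip x.
Proof. by rewrite /enorm ipZl ipZr mulrA -expr2 sqrtrM ?sqr_ge0 // sqrtr_sqr. Qed.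

(** Test both expansions along d = g - g': with |d| / 4 as tolerance, the two errors add up to at
    most half of <d, t d>. *)
Lemma gradient_unique f x g g' :
  is_gradient ip f x g -> is_gradient ip f x g' -> g = g'.
Proof.
move=> f_g f_g'; apply/eqP; rewrite -subr_eq0; apply: contraT => d_neq0.
set d := g - g' in d_neq0; pose n := enorm ip d.
have n2 : n ^+ 2 = ip d d := enorm_sqr d.
have n_gt0 : 0 < n by rewrite sqrtr_gt0 ip_gt0.
have eps_gt0 : 0 < n / 4 by lra.
have [del del_gt0 f_del] := f_g _ eps_gt0.
have [del' del'_gt0 f_del'] := f_g' _ eps_gt0.
(* The displacement t d has norm r / 2, strictly inside both radii. *)
pose r := Num.min del del'; pose t := r / (2 * n).
have r_gt0 : 0 < r by rewrite lt_min del_gt0.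
have t_gt0 : 0 < t by rewrite divr_gt0 // mulr_gt0.
have th : enorm ip (t *: d) = t * n by rewrite enormZ gtr0_norm.
have tn : t * n = r / 2 by rewrite /t; field; rewrite gt_eqF.
have [r_del r_del'] : r <= del /\ r <= del' by rewrite !ge_min !lexx orbT.
have := f_del (t *: d); have := f_del' (t *: d); rewrite th.
have -> : t * n < del by lra.
have -> : t * n < del' by lra.
move=> /(_ isT); rewrite ler_norml => /andP [_ le1].
move=> /(_ isT); rewrite ler_norml => /andP [le2 _].
have : ip g (t *: d) - ip g' (t *: d) = t * n * n.
  by rewrite -mulrA -expr2 n2 -ipNl -ipDl ipZr.
have : 0 < t * n * n by do 2?apply: mulr_gt0.
by move: le1 le2; lra.
Qed.

Lemma gradientE f x g : is_gradient ip f x g -> gradient ip f x = g.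
Proof.
move=> f_g; rewrite /gradient; case: xgetP => [g' _ f_g'|/(_ g)//].
exact: gradient_unique f_g' f_g.
Qed.

Lemma is_gradient_quadratic f x g K :
  (forall h, enorm ip h <= 1 -> `|f (x + h) - f x - ip g h| <= K * ip h h) ->
  is_gradient ip f x g.
Proof.
move=> f_K eps eps_gt0.
(* A positive upper bound for [K], whose sign is unknown, to divide by. *)
have K1_gt0 : 0 < `|K| + 1 by rewrite ltr_wpDl.
exists (Num.min 1 (eps / (`|K| + 1))); first by rewrite lt_min ltr01 divr_gt0.
move=> h; rewrite lt_min => /andP [/ltW h1 h_eps].
apply: (le_trans (f_K h h1)); rewrite -enorm_sqr expr2 mulrA.
apply: ler_wpM2r; first exact: enorm_ge0.
move: h_eps; rewrite ltr_pdivlMr // => /ltW; apply: le_trans; rewrite mulrC.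
by apply: ler_wpM2l; [exact: enorm_ge0|have := ler_norm K; lra].
Qed.

End Gradient.

(** * Closure of [H] under the calculus, and differentiation of the potential *)

Section Regularizer.
Variables (R : realType) (X : vectType R) (ip : {dot X for (@idfun R)}).
Variables (H : {vspace 'End(X)}).
Hypothesis H_sa : forall A, A \in H -> selfadjoint ip A.
Hypothesis H_id : \1%VF \in H.
Hypothesis H_quad : forall A F, A \in H -> F \in H -> (A \o F \o A)%VF \in H.
Hypothesis H_proj : forall A, posdef ip A -> posdef ip (orthproj ip H A).
Implicit Types (A B C E M S V : 'End(X)) (h m w x y z : X) (t eta : R).

Lemma memv_opoly A p : A \in H -> opoly A p \in H.
Proof.
move=> A_H; apply: memv_suml => i _; apply: memvZ.
(* [H_quad] raises exponents by two, A^(n+2) = A A^n A, so two consecutive powers are carried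
   along. *)
suff: oppow A i \in H /\ oppow A i.+1 \in H by case.
elim: (i : nat) => [|n [IHn IHn1]]; first by rewrite /= comp_lfun1r.
split=> //; rewrite oppowSr [oppow A n.+1]/=.
exact: H_quad.
Qed.

Lemma memv_opsqrt A : psd ip A -> A \in H -> opsqrt ip A \in H.
Proof. by move=> /opsqrt_poly [p ->]; exact: memv_opoly. Qed.

Lemma memv_inv A : posdef ip A -> A \in H -> (A^-1)%VF \in H.
Proof. by move=> /posdef_inv_poly [p ->]; exact: memv_opoly. Qed.

Let P m := orthproj ip H (out ip m).

Lemma psd_P m : psd ip (P m).
Proof. exact: psd_orthproj (psd_out ip m). Qed.

Lemma P_H m : P m \in H.
Proof. by case: (orthprojP H_sa (out ip m)). Qed.

Lemma optrace_P m C : C \in H -> optrace (P m \o C)%VF = ip m (C m).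
Proof. by move=> C_H; rewrite (proj2 (orthprojP H_sa _)) // optrace_out. Qed.

Lemma Psi_starE eta S m : posdef ip S ->
  Psi_star ip H eta S m = eta * optrace (opsqrt ip (P m + S)).
Proof.
move=> S_pos; rewrite /Psi_star trnorm_psd //.
exact/psd_opsqrt/posdef_psd/(posdefDl (psd_P m)).
Qed.

(* With E = B (m + h) - B m and V = (B m)^-1, optrace_expand gives the remainder
   (<h, V h> - tr (E V E)) / 2 exactly, and optrace_sylvester bounds
   tr (E (B m) E) by <h, E (2 m + h)>, which makes tr (E E) of order |h|^2. *)
Lemma quadratic_remainder S m : S \in H -> posdef ip S ->
  let B x := opsqrt ip (P x + S) in
  exists K, forall h, enorm ip h <= 1 ->
    `|optrace (B (m + h)) - optrace (B m) - ip ((B m)^-1%VF m) h| <= K * ip h h.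
Proof.
move=> S_H S_pos B.
have A_pos x : posdef ip (P x + S) := posdefDl (psd_P x) S_pos.
have A_H x : P x + S \in H := memvD (P_H x) S_H.
have B_pos x : posdef ip (B x) := posdef_opsqrt (A_pos x).
have B_H x : B x \in H := memv_opsqrt (posdef_psd (A_pos x)) (A_H x).
have BB x : (B x \o B x)%VF = P x + S := opsqrtK (posdef_psd (A_pos x)).
set V := ((B m)^-1)%VF.
have V_pos : posdef ip V := posdef_inv (B_pos m).
have V_psd := posdef_psd V_pos; have [V_sa _] := V_psd.
have V_H : V \in H := memv_inv (B_pos m) (B_H m).
(* The trace bounds [V]; adding 1 keeps [b] positive even if [X] is 0. *)
pose b := optrace V + 1.
have b_gt0 : 0 < b by rewrite ltr_wpDl // (optrace_ge0 V_psd).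
have V_le x : ip x (V x) <= b * ip x x.
  by have := ip_le_optrace x V_psd; have := ip_ge0 ip x; rewrite /b; lra.
have bV : psd ip (b *: \1%VF - V).
  split=> [x y|x]; rewrite !add_lfunE !opp_lfunE !scale_lfunE !id_lfunE !ipE.
    by rewrite V_sa.
  by rewrite subr_ge0.
have bB : psd ip (b *: B m - \1%VF) := psd_inv_bound (B_pos m) b_gt0 V_le.
(* The first [b] bounds <h, V h>. The rest bounds tr (E V E) <= b tr (E E) <= b^3 |w|^2 |h|^2, where
   w = 2 m + h and |w|^2 <= 8 |m|^2 + 2. *)
exists (b + b ^+ 3 * (8 * ip m m + 2)) => h h_le1.
have hh_ge0 := ip_ge0 ip h; have mm_ge0 := ip_ge0 ip m.
have hh_le1 : ip h h <= 1 by rewrite -enorm_sqr expr_le1 ?enorm_ge0.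
pose E := B (m + h) - B m; pose w := m + m + h.
have E_H : E \in H by rewrite memvB.
have E_sa := H_sa E_H.
have dA C : C \in H ->
    optrace (((B (m + h) \o B (m + h)) - (B m \o B m)) \o C)%VF
      = ip (m + h) (C (m + h)) - ip m (C m).
  by move=> C_H; rewrite !BB opprD addrACA subrr addr0 !optrace_bilin !optrace_P.
have s_ge0 : 0 <= optrace (E \o E)%VF := optrace_ge0 (psd_sqr E_sa).
have ECE_ge0 := optrace_ge0 (psd_conj E_sa (posdef_psd (B_pos (m + h)))).
have EBE : optrace (E \o B m \o E)%VF <= ip h (E w).
  have := optrace_sylvester (B m) (B (m + h)); rewrite -/E dA //.
  rewrite (ip_quadratic_diff_mid _ _ E_sa) => <-.
  exact: ler_wpDl ECE_ge0 (lexx _).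
have EE_EBE : optrace (E \o E)%VF <= b * optrace (E \o B m \o E)%VF
  := optrace_conj_ge bB E_sa.
have ww : ip w w <= 8 * ip m m + 2.
  by apply: (le_trans (ip_double_le ip m h)); rewrite lerD2l ler_piMr.
have ww_ge0 := ip_ge0 ip w.
set s := optrace (E \o E)%VF in s_ge0 EE_EBE *.
(* Cauchy-Schwarz with |E w|^2 <= s |w|^2; as s <= b <h, E w>, the bound feeds back into [s] through
   [le_of_sqr_le]. *)
have hEw : ip h (E w) ^+ 2 <= ip w w * ip h h * s.
  apply: (le_trans (cauchy_schwarz ip h (E w))).
  rewrite mulrAC mulrC; apply: ler_wpM2r => //.
  by rewrite mulrC E_sa -comp_lfunE; apply/ip_le_optrace/psd_sqr.
have s_le : s <= b ^+ 2 * (ip w w * ip h h).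
  apply: le_of_sqr_le s_ge0 (mulr_ge0 ww_ge0 hh_ge0) _ hEw.
  by apply: (le_trans EE_EBE); apply: ler_wpM2l => //; exact: ltW.
have EVE_le : optrace (E \o V \o E)%VF <= b ^+ 3 * (8 * ip m m + 2) * ip h h.
  apply: (le_trans (optrace_conj_le bV E_sa)); rewrite -/s.
  have b3 (c e : R) : b ^+ 3 * c * e = b * (b ^+ 2 * (c * e)).
    by rewrite exprS !mulrA.
  rewrite b3; apply: ler_wpM2l; first exact: ltW.
  apply: (le_trans s_le); apply: ler_wpM2l; first exact: sqr_ge0.
  exact: ler_wpM2r.
have EVE_ge0 := optrace_ge0 (psd_conj E_sa V_psd).
rewrite (optrace_expand (B (m + h)) (B_pos m)) -/E -/V dA // V_sa.
rewrite (ip_quadratic_diff _ _ V_sa).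
exact: half_diff_le (proj2 V_psd h) (V_le h) EVE_ge0 EVE_le.
Qed.

Lemma gradient_Psi_star eta S m : 0 < eta -> S \in H -> posdef ip S ->
  gradient ip (Psi_star ip H eta S) m = eta *: (opsqrt ip (P m + S))^-1%VF m.
Proof.
move=> eta_gt0 S_H S_pos; apply: gradientE.
have [K K_le] := quadratic_remainder m S_H S_pos.
apply: (@is_gradient_quadratic _ _ _ _ _ _ (eta * K)) => h /K_le {}K_le.
rewrite !Psi_starE // ipZl -!mulrBr normrM gtr0_norm // -mulrA.
by apply: ler_wpM2l => //; exact: ltW.
Qed.

End Regularizer.

Theorem lemma4 (R : realType) (X : vectType R) (ip : {dot X for (@idfun R)})
    (H : {vspace 'End(X)})
    (H_selfadjoint : forall A : 'End(X), A \in H -> selfadjoint ip A)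
    (H_id : \1%VF \in H)
    (H_quad : forall A F : 'End(X), A \in H -> F \in H ->
       (A \o F \o A)%VF \in H)
    (H_proj : forall A : 'End(X), posdef ip A -> posdef ip (orthproj ip H A))
    (eta : R) (eta_gt0 : 0 < eta)
    (Sk Sk1 : 'End(X))
    (Sk_H : Sk \in H) (Sk_pos : posdef ip Sk)
    (Sk1_H : Sk1 \in H) (Sk1_pos : posdef ip Sk1)
    (Sk_le_Sk1 : loewner_le ip Sk Sk1)
    (m : X) :
  opnormsq ip (opsqrt ip Sk1)
    (gradient ip (Psi_star ip H eta Sk1) m
     - gradient ip (Psi_star ip H eta Sk) m)
  <= eta ^+ 2 * (trnorm ip (opsqrt ip Sk1) - trnorm ip (opsqrt ip Sk)).
Proof.
rewrite !gradient_Psi_star // !trnorm_psd; try exact/psd_opsqrt/posdef_psd.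
set M := orthproj ip H (out ip m).
have M_psd : psd ip M := psd_P H_selfadjoint H_id H_proj m.
have M_H : M \in H := P_H H_selfadjoint m.
have A0_pos := posdefDl M_psd Sk_pos; have A1_pos := posdefDl M_psd Sk1_pos.
set B0 := opsqrt ip (M + Sk); set B1 := opsqrt ip (M + Sk1).
have B0_pos : posdef ip B0 := posdef_opsqrt A0_pos.
have B1_pos : posdef ip B1 := posdef_opsqrt A1_pos.
have B0_H : B0 \in H.
  by apply: memv_opsqrt => //; [exact: posdef_psd|exact: memvD].
have B1_H : B1 \in H.
  by apply: memv_opsqrt => //; [exact: posdef_psd|exact: memvD].
pose D := (B1^-1)%VF - (B0^-1)%VF.
have D_H : D \in H := memvB (memv_inv H_id H_quad B1_pos B1_H)
  (memv_inv H_id H_quad B0_pos B0_H).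
have DBD_H : (D \o B1 \o D)%VF \in H by exact: H_quad.
have leB : loewner_le ip B0 B1.
  by apply: opsqrt_le => //; rewrite /loewner_le opprD addrACA subrr add0r.
have leSB : loewner_le ip (opsqrt ip Sk1) B1.
  by apply: opsqrt_le => //; rewrite /loewner_le addrK.
have -> : eta *: (B1^-1)%VF m - eta *: (B0^-1)%VF m = eta *: D m.
  by rewrite -scalerBr /D add_lfunE opp_lfunE.
rewrite /opnormsq linearZ /= ipZl ipZr mulrA -expr2.
apply: ler_wpM2l; first exact: sqr_ge0.
have := proj2 leSB (D m); rewrite add_lfunE opp_lfunE ipDr ipNr subr_ge0.
move=> /le_trans; apply.
(* As D B1 D lies in [H], [out ip m] may be replaced by its projection [M]. *)
have -> : ip (D m) (B1 (D m)) = optrace (M \o (D \o B1 \o D))%VF.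
  by rewrite optrace_P // !comp_lfunE (H_selfadjoint D).
apply: le_trans (optrace_sqrt_diff_le M_psd Sk_pos Sk1_pos Sk_le_Sk1).
apply: (optrace_inv_diff_le B0_pos B1_pos leB).
(* The remaining operator B0^2 - M is [Sk]. *)
rewrite opsqrtK; last exact: posdef_psd.
by rewrite addrC addKr; exact: posdef_psd.
Qed.
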